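(* Let $K$ be an h-convex body of the hyperbolic plane with diameter $d$ and thickness $t$. Then $K$ contains a circle of radius $r$, where $r$ is given by $$\tanh r=\frac{\sinh t\cosh t}{3\cosh^2 d+\sinh^2 t}.$$
   Context: The hyperbolic plane has curvature $-1$; $\mathcal I$ denotes the set of its ideal points. A body is a compact set with nonempty interior. A set is h-convex if with every pair $x,y$ of its points it contains the intersection of all paracyclic (horocyclic) domains, i.e. horodisks, containing $x$ and $y$; every h-convex set is convex. The diameter is the greatest distance between two points of $K$. For distinct $X,Y\in\mathcal I$, $YX$ denotes the hyperbolic line with ideal endpoints $Y$ and $X$. If $YX$ meets $K$, there are two hypercycles (distance curves) with leading line $YX$, one on each side of it (possibly degenerating to $YX$ itself), which touch $K$ and such that the strip between them contains $K$. Let $d_K^+(YX)$ and $d_K^-(YX)$ be the distances of these two hypercycles from $YX$; that is, $d_K^{\pm}(YX)$ is the maximal distance from $YX$ of a point of $K$ in the respective closed half-plane bounded by $YX$. Put $d_K(YX)=d_K^+(YX)+d_K^-(YX)$. The thickness of $K$ in the direction $X\in\mathcal I$ is $\mathrm{thi}_K(X)=\inf\{d_K(YX): YX\cap K\neq\emptyset\}$ (infimum over $Y\in\mathcal I\setminus\{X\}$), and the thickness of $K$ is $\mathrm{thi}(K)=\inf\{\mathrm{thi}_K(X): X\in\mathcal I\}$. *)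

(* Defs.v *)
(* MathComp / MathComp-Analysis world. *)
From HB Require Import structures.
From mathcomp Require Import all_boot all_order all_algebra.
From mathcomp Require Import all_classical all_reals all_analysis.

Set Implicit Arguments.
Unset Strict Implicit.
Unset Printing Implicit Defensive.

Import Order.TTheory GRing.Theory Num.Theory.
Import numFieldNormedType.Exports.

Local Open Scope classical_set_scope.
Local Open Scope ring_scope.

Section HyperbolicFunctions.
Variable R : realType.
Implicit Types x : R.

Definition cosh x : R := (expR x + expR (- x)) / 2.
Definition sinh x : R := (expR x - expR (- x)) / 2.
Definition tanh x : R := sinh x / cosh x.
(* Meaningful for 1 <= x only. *)
Definition arcosh x : R := ln (x + Num.sqrt (x ^+ 2 - 1)).

End HyperbolicFunctions.

(* The hyperbolic plane of curvature -1 is the hyperboloid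
     x1^2 + x2^2 - x3^2 = -1,  x3 > 0
   in Minkowski space, parametrized by its orthogonal projection to R * R:
   p = (p1, p2) stands for (p1, p2, sqrt (1 + p1^2 + p2^2)).  The projection is
   a homeomorphism onto the whole of R * R, so compactness and interior are
   those of the product topology of R * R.
   The ideal points are the null directions of the upper cone; u = (u1, u2) on
   the unit circle stands for the direction of (u1, u2, 1). *)
Section HyperbolicPlane.
Variable R : realType.
Implicit Types (p q c : R * R) (X Y : R * R) (K : set (R * R)).

Definition dot p q : R := p.1 * q.1 + p.2 * q.2.

(* The third coordinate on the hyperboloid. *)
Definition height p : R := Num.sqrt (1 + dot p p).

(* cosh of the distance is minus the Minkowski product. *)
Definition hdist p q : R := arcosh (height p * height q - dot p q).

Definition hdisk c (r : R) : set (R * R) := [set p | hdist c p <= r].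

Definition ideal : set (R * R) := [set X | dot X X = 1].

(* The determinant with rows (Y1, Y2, 1), (X1, X2, 1), (p1, p2, height p).  It
   vanishes iff p lies in the plane spanned by the null vectors of Y and X,
   which cuts the hyperboloid in the line YX; its sign tells the side of p. *)
Definition side Y X p : R :=
  p.1 * (Y.2 - X.2) - p.2 * (Y.1 - X.1) + height p * (Y.1 * X.2 - Y.2 * X.1).

Definition hline Y X : set (R * R) := [set p | side Y X p = 0].
Definition halfplane_pos Y X : set (R * R) := [set p | 0 <= side Y X p].
Definition halfplane_neg Y X : set (R * R) := [set p | side Y X p <= 0].

(* The closed horodisks centred at X are the sublevel sets of minus the
   Minkowski product with the null vector (X1, X2, 1), at levels a > 0. *)
Definition horodisk X (a : R) : set (R * R) := [set p | height p - dot p X <= a].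

Definition hconvex K : Prop :=
  forall x y, K x -> K y ->
  forall z,
    (forall X a, ideal X -> 0 < a ->
       horodisk X a x -> horodisk X a y -> horodisk X a z) ->
  K z.

Definition body K : Prop := compact K /\ K° !=set0.

Definition diameter K : R := sup [set hdist p.1 p.2 | p in K `*` K].

Definition dist_line Y X p : R := inf [set hdist p q | q in hline Y X].

Definition width_pos K Y X : R :=
  sup [set dist_line Y X p | p in K `&` halfplane_pos Y X].
Definition width_neg K Y X : R :=
  sup [set dist_line Y X p | p in K `&` halfplane_neg Y X].
Definition width K Y X : R := width_pos K Y X + width_neg K Y X.

Definition thickness_dir K X : R :=
  inf [set width K Y X | Y in
        [set Y | ideal Y /\ Y <> X /\ hline Y X `&` K !=set0]].

Definition thickness K : R := inf [set thickness_dir K X | X in ideal].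

End HyperbolicPlane.

(* Main.v *)
(* Lift points to the hyperboloid in Minkowski space and let p1, p2, p3 in K
   maximize the determinant of their lifts.  By Cramer's rule every lift of a
   point of K is a combination of the three with coefficients in [-1, 1], so a
   linear form f that is nonnegative on K satisfies f <= f(p1 + p2 + p3) on K.
   Let c be the normalization of p1 + p2 + p3; the Minkowski norm of the sum is
   at most sqrt (3 + 6 cosh d).  If some z outside K were within distance r of
   c, take x in K nearest to z: since K is geodesically convex, the
   perpendicular to xz at x is a support line of K, the zero set of some f of
   unit norm.  As f is sinh of the distance from that line, the thickness
   condition forces f(p1 + p2 + p3) >= sinh t, hence
   f(c) >= sinh t / sqrt (3 + 6 cosh d), while c and z lie on different sides,
   so sinh r > f(c).  This contradicts the value of r because t <= d. *)
Require Import Defs.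
From HB Require Import structures.
From mathcomp Require Import all_boot all_order all_algebra.
From mathcomp Require Import all_classical all_reals all_analysis.
From mathcomp Require Import ring lra.
Import Order.TTheory GRing.Theory Num.Theory.
Import numFieldNormedType.Exports.
Local Open Scope classical_set_scope.
Local Open Scope ring_scope.

(** * Hyperbolic functions and [arcosh] *)

Lemma cosh2_sinh2 {R : realType} (x : R) : cosh x ^+ 2 = 1 + sinh x ^+ 2.
Proof.
have := expRxMexpNx_1 x; rewrite /cosh /sinh.
move: (expR x) (expR (- x)) => a b ab.
by rewrite -[X in _ = X + _]ab; field.
Qed.

Lemma cosh_gt0 {R : realType} (x : R) : 0 < cosh x.
Proof. by rewrite /cosh divr_gt0// addr_gt0// expR_gt0. Qed.

Lemma cosh_ge1 {R : realType} (x : R) : 1 <= cosh x.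
Proof. have := cosh2_sinh2 x; have := cosh_gt0 x; nra. Qed.

Lemma ler_sinh {R : realType} (x y : R) : x <= y -> sinh x <= sinh y.
Proof.
move=> xy; rewrite /sinh ler_pM2r// lerB// ler_expR//.
by rewrite lerN2.
Qed.

Lemma sinh0 {R : realType} : sinh 0 = 0 :> R.
Proof. by rewrite /sinh oppr0 subrr mul0r. Qed.

Lemma sinh_ge0 {R : realType} (x : R) : 0 <= x -> 0 <= sinh x.
Proof. by move=> /ler_sinh; rewrite sinh0. Qed.

Lemma sinh_lt0 {R : realType} (x : R) : x < 0 -> sinh x < 0.
Proof. by move=> x0; rewrite /sinh pmulr_llt0// subr_lt0 ltr_expR; lra. Qed.

Lemma ler_cosh {R : realType} (x y : R) : 0 <= x -> x <= y -> cosh x <= cosh y.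
Proof.
move=> x0 xy.
have := cosh2_sinh2 x; have := cosh2_sinh2 y.
have := ler_sinh _ _ xy; have := sinh_ge0 _ x0; have := cosh_gt0 x.
have := cosh_gt0 y; nra.
Qed.

Lemma arcosh_arg_ge1 {R : realType} (x : R) :
  1 <= x -> 1 <= x + Num.sqrt (x ^+ 2 - 1).
Proof. by move=> x1; rewrite (le_trans x1)// lerDl sqrtr_ge0. Qed.

Lemma arcosh_ge0 {R : realType} (x : R) : 1 <= x -> 0 <= arcosh x.
Proof. by move=> x1; apply/ln_ge0/arcosh_arg_ge1. Qed.

Lemma arcoshK {R : realType} (x : R) : 1 <= x -> cosh (arcosh x) = x.
Proof.
move=> x1; have y1 := arcosh_arg_ge1 x x1.
rewrite /cosh /arcosh expRN lnK ?posrE ?(lt_le_trans _ y1)//.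
have x2 : 0 <= x ^+ 2 - 1 by nra.
have := sqr_sqrtr x2; set s := Num.sqrt _ in y1 * => sE.
have -> : (x + s)^-1 = x - s.
  apply: (@mulfI _ (x + s)); first by rewrite lt0r_neq0// (lt_le_trans _ y1).
  rewrite mulfV ?lt0r_neq0 ?(lt_le_trans _ y1)//.
  have -> : (x + s) * (x - s) = x ^+ 2 - s ^+ 2 by ring.
  by rewrite sE; ring.
by field.
Qed.

Lemma ler_arcosh {R : realType} (x y : R) :
  1 <= x -> x <= y -> arcosh x <= arcosh y.
Proof.
move=> x1 xy; have y1 := le_trans x1 xy.
rewrite /arcosh ler_ln ?posrE.
- by rewrite lerD// ler_sqrt; nra.
- exact: lt_le_trans (arcosh_arg_ge1 _ x1).
- exact: lt_le_trans (arcosh_arg_ge1 _ y1).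
Qed.

(** * The Minkowski product and the hyperbolic distance *)

(* Minus the Minkowski product of the lifts, that is, cosh (hdist p q). *)
Definition mink {R : realType} (p q : R * R) : R := height p * height q - dot p q.

Lemma height_sqr {R : realType} (p : R * R) : height p ^+ 2 = 1 + p.1 ^+ 2 + p.2 ^+ 2.
Proof. by rewrite sqr_sqrtr /dot; [ring|nra]. Qed.

Lemma height_gt0 {R : realType} (p : R * R) : 0 < height p.
Proof. by rewrite sqrtr_gt0 /dot; nra. Qed.

Lemma heightE {R : realType} (p : R * R) (h : R) :
  0 < h -> h ^+ 2 = 1 + p.1 ^+ 2 + p.2 ^+ 2 -> height p = h.
Proof.
move=> h0 hE; apply/eqP; rewrite -(@eqrXn2 _ 2) ?ltW ?height_gt0//.
by rewrite height_sqr hE.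
Qed.

Lemma minkC {R : realType} (p q : R * R) : mink p q = mink q p.
Proof. by rewrite /mink /dot; ring. Qed.

Lemma minkxx {R : realType} (p : R * R) : mink p p = 1.
Proof. by rewrite /mink -expr2 height_sqr /dot; ring. Qed.

(** By Lagrange's identity the square of [height p * height q] exceeds that of [1 + dot p q] by the
    squared Euclidean distance of [p] and [q] plus another square. *)
Lemma mink_gt1 {R : realType} (p q : R * R) : p <> q -> 1 < mink p q.
Proof.
move=> pq; rewrite /mink ltrBrDr /dot.
have hp := height_gt0 p; have hq := height_gt0 q.
have hpq := mulr_gt0 hp hq.
have : 0 < (p.1 - q.1) ^+ 2 + (p.2 - q.2) ^+ 2.
  rewrite lt0r addr_ge0 ?sqr_ge0// andbT paddr_eq0 ?sqr_ge0// !sqrf_eq0 !subr_eq0.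
  apply/negP => /andP[/eqP p1 /eqP p2]; apply: pq.
  by rewrite [p]surjective_pairing p1 p2 -surjective_pairing.
have E : (height p * height q) ^+ 2 =
  (1 + (p.1 * q.1 + p.2 * q.2)) ^+ 2 + (p.1 - q.1) ^+ 2 + (p.2 - q.2) ^+ 2 +
  (p.1 * q.2 - p.2 * q.1) ^+ 2.
  by rewrite exprMn !height_sqr; ring.
have := sqr_ge0 (p.1 * q.2 - p.2 * q.1).
move: E hpq; move: (height p * height q) (_ + p.2 * q.2) => H s E H0 D0 N0.
rewrite ltNge; apply/negP => sH.
have : H ^+ 2 <= (1 + s) ^+ 2 by rewrite ler_sqr ?nnegrE; lra.
lra.
Qed.

Lemma mink_ge1 {R : realType} (p q : R * R) : 1 <= mink p q.
Proof.
have [->|/eqP pq] := eqVneq p q; first by rewrite minkxx.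
exact/ltW/mink_gt1.
Qed.

Lemma hdist_ge0 {R : realType} (p q : R * R) : 0 <= hdist p q.
Proof. exact/arcosh_ge0/mink_ge1. Qed.

Lemma cosh_hdist {R : realType} (p q : R * R) : cosh (hdist p q) = mink p q.
Proof. exact/arcoshK/mink_ge1. Qed.

Lemma hdistxx {R : realType} (p : R * R) : hdist p p = 0.
Proof.
by rewrite /hdist -/(mink p p) minkxx /arcosh expr1n subrr sqrtr0 addr0 ln1.
Qed.

(** * Determinants, linear forms and lines *)

(* The determinant of the lifts to the hyperboloid. *)
Definition det3 {R : realType} (p q s : R * R) : R :=
  p.1 * (q.2 * height s - height q * s.2) -
  p.2 * (q.1 * height s - height q * s.1) +
  height p * (q.1 * s.2 - q.2 * s.1).

(** The left side is the Gram determinant of the three lifts for [mink], a form of signature (1, 2).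
    Its nonnegativity will bound the value at [c] of the support form through the distances of [x]
    from [z] and [c]. *)
Lemma mink_gram {R : realType} (z x c : R * R) :
  (mink z x ^+ 2 - 1) * (mink x c ^+ 2 - 1) - (mink z c - mink z x * mink x c) ^+ 2
  = det3 z x c ^+ 2.
Proof.
(* [g] is 1 on lifts; inserting it makes both sides homogeneous, so the identity becomes polynomial
   with the heights as free variables. *)
pose g (p : R * R) := height p ^+ 2 - p.1 ^+ 2 - p.2 ^+ 2.
have gE p : g p = 1 by rewrite /g height_sqr; ring.
transitivity ((mink z x ^+ 2 - g z * g x) * (mink x c ^+ 2 - g x * g c) -
  (mink z c * g x - mink z x * mink x c) ^+ 2); first by rewrite !gE !mulr1.
transitivity (det3 z x c ^+ 2 * g x); last by rewrite gE mulr1.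
by rewrite /g /mink /det3 /dot; ring.
Qed.

(** The normal vector is [(a, b, - c)]; the zero set is a hyperbolic line when its Minkowski square
    [a ^+ 2 + b ^+ 2 - c ^+ 2] is positive. *)
Definition linform {R : realType} (a b c : R) (p : R * R) : R :=
  a * p.1 + b * p.2 + c * height p.

Lemma det3_cramer {R : realType} (a b c : R) (p q s v : R * R) :
  det3 p q s * linform a b c v =
  det3 v q s * linform a b c p + det3 p v s * linform a b c q + det3 p q v * linform a b c s.
Proof. by rewrite /det3 /linform; ring. Qed.

(** A timelike vector on the lower cone would pair with a lift with the wrong sign, by
    Cauchy-Schwarz. This puts the projection in [foot] on the upper sheet. *)
Lemma height_pos {R : realType} (p : R * R) (v1 v2 v3 : R) :
  v1 ^+ 2 + v2 ^+ 2 < v3 ^+ 2 -> 0 < height p * v3 - p.1 * v1 - p.2 * v2 -> 0 < v3.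
Proof.
move=> vlt pv; rewrite ltNge; apply/negP => v3le.
have hp := height_gt0 p; have hE := height_sqr p.
have hv : height p * v3 <= 0 by rewrite pmulr_rle0.
have : (p.1 * v1 + p.2 * v2) ^+ 2 <= (height p * v3) ^+ 2.
  rewrite exprMn hE.
  apply: (@le_trans _ _ ((p.1 ^+ 2 + p.2 ^+ 2) * (v1 ^+ 2 + v2 ^+ 2))).
    by have := sqr_ge0 (p.1 * v2 - p.2 * v1); lra.
  by apply: ler_pM; rewrite ?addr_ge0 ?sqr_ge0//; [lra|exact: ltW].
rewrite -[X in X <= _]sqrrN -[X in _ <= X]sqrrN ler_sqr ?nnegrE; lra.
Qed.

(* q is the foot of the perpendicular from p to the line of the form. *)
Lemma foot {R : realType} (a b c : R) (p : R * R) :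
  let N := a ^+ 2 + b ^+ 2 - c ^+ 2 in 0 < N ->
  exists2 q, linform a b c q = 0 & mink p q = Num.sqrt (1 + linform a b c p ^+ 2 / N).
Proof.
move=> N N0; set f := linform a b c p.
set s := Num.sqrt _.
have arg0 : 0 < 1 + f ^+ 2 / N.
  by rewrite ltr_pwDl// divr_ge0 ?sqr_ge0// ltW.
have s0 : 0 < s by rewrite sqrtr_gt0.
have sE : s ^+ 2 = 1 + f ^+ 2 / N by rewrite sqr_sqrtr// ltW.
have hE := height_sqr p.
(* Orthogonal projection of the lift of [p] onto the plane of the form: [f / N] times the normal is
   subtracted. Its Minkowski square is [- s ^+ 2], so dividing by [s] returns to the hyperboloid. *)
pose v1 := p.1 - f / N * a; pose v2 := p.2 - f / N * b.
pose v3 := height p + f / N * c.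
have fE : f = a * p.1 + b * p.2 + c * height p by [].
have NE : N = a ^+ 2 + b ^+ 2 - c ^+ 2 by [].
have kN : f / N * N = f by rewrite divfK// lt0r_neq0.
have sE' : s ^+ 2 = 1 + f / N * f by rewrite sE; ring.
have vE : v3 ^+ 2 = s ^+ 2 + v1 ^+ 2 + v2 ^+ 2.
  apply/eqP; rewrite -subr_eq0; apply/eqP.
  rewrite sE' /v1 /v2 /v3; move: (f / N) kN => k kN.
  transitivity (k * (f - k * N) + 2 * k * (a * p.1 + b * p.2 + c * height p - f)
   + (height p ^+ 2 - (1 + p.1 ^+ 2 + p.2 ^+ 2))); first by rewrite NE; ring.
  by rewrite -fE kN hE; ring.
have pv : height p * v3 - p.1 * v1 - p.2 * v2 = s ^+ 2.
  rewrite sE' /v1 /v2 /v3; move: (f / N) kN => k kN.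
  transitivity (height p ^+ 2 - p.1 ^+ 2 - p.2 ^+ 2 +
    k * (a * p.1 + b * p.2 + c * height p)); first by ring.
  by rewrite -fE hE; ring.
have v30 : 0 < v3.
  apply: (@height_pos _ p v1 v2); last by rewrite pv exprn_gt0.
  by rewrite vE -addrA ltrDr exprn_gt0.
have hq : height (v1 / s, v2 / s) = v3 / s.
  apply: heightE; first exact: divr_gt0.
  rewrite /= !expr_div_n vE -addrA mulrDl divff; last by rewrite expf_neq0// lt0r_neq0.
  by rewrite mulrDl addrA.
exists (v1 / s, v2 / s).
  rewrite /linform hq /=.
  transitivity ((f - f / N * N) / s); last by rewrite kN subrr mul0r.
  by rewrite /v1 /v2 /v3; move: (f / N) => k; rewrite fE NE; ring.
rewrite /mink /dot hq /=.
transitivity ((height p * v3 - p.1 * v1 - p.2 * v2) / s); first by ring.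
by rewrite pv expr2 mulfK// lt0r_neq0.
Qed.

(* X and Y are the points where the chord a x + b y + c = 0 meets the unit
   circle. *)
Lemma form_side {R : realType} (a b c : R) :
  0 < a ^+ 2 + b ^+ 2 - c ^+ 2 ->
  exists X Y : R * R, [/\ ideal X, ideal Y, Y <> X &
    exists2 l, 0 < l & forall p, side Y X p = l * linform a b c p].
Proof.
set N := _ - _ => N0.
pose w := Num.sqrt N; have w0 : 0 < w by rewrite sqrtr_gt0.
have wE : w ^+ 2 = a ^+ 2 + b ^+ 2 - c ^+ 2 by rewrite sqr_sqrtr// ltW.
pose r := a ^+ 2 + b ^+ 2.
have r0 : 0 < r by have := sqr_ge0 c; rewrite /r; move: N0; rewrite /N; lra.
have rn0 : a ^+ 2 + b ^+ 2 != 0 by rewrite lt0r_neq0.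
have c2 : c ^+ 2 = r - w ^+ 2 by rewrite wE /r; ring.
(* The sign of [w] decides which endpoint is [X]; exchanging the two would make the factor [l]
   negative. *)
pose X := ((- c * a + w * b) / r, (- c * b - w * a) / r).
pose Y := ((- c * a - w * b) / r, (- c * b + w * a) / r).
have XY : forall p, side Y X p = (2 * w / r) * linform a b c p.
  move=> p; rewrite /side /linform /X /Y /=.
  by rewrite /r; field.
exists X, Y; split.
- rewrite /ideal /dot /X /=.
  transitivity ((c ^+ 2 + w ^+ 2) * r / r ^+ 2); first by rewrite /r; field.
  by rewrite c2 subrK -expr2 divff// expf_neq0.
- rewrite /ideal /dot /Y /=.
  transitivity ((c ^+ 2 + w ^+ 2) * r / r ^+ 2); first by rewrite /r; field.
  by rewrite c2 subrK -expr2 divff// expf_neq0.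
- move=> [] /(mulIf (invr_neq0 rn0)) e1 /(mulIf (invr_neq0 rn0)) e2.
  have wa : w * a = 0 by lra.
  have wb : w * b = 0 by lra.
  move/eqP: wa; rewrite mulf_eq0 gt_eqF//= => /eqP a0.
  move/eqP: wb; rewrite mulf_eq0 gt_eqF//= => /eqP b0.
  by move: rn0; rewrite a0 b0 expr0n addr0 eqxx.
- by exists (2 * w / r) => //; rewrite divr_gt0// mulr_gt0.
Qed.

(** * Upper bounds for the thickness *)

(** On an empty or unbounded set [sup] has the default value 0, which also satisfies the bound. *)
Lemma sup_ge0 {R : realType} (E : set R) : (forall x, E x -> 0 <= x) -> 0 <= sup E.
Proof.
move=> E0; have [[[x Ex] ubE]|/sup_out->//] := pselect (has_sup E).
exact: le_trans (E0 _ Ex) (ub_le_sup ubE Ex).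
Qed.

Lemma inf_ge0 {R : realType} (E : set R) : (forall x, E x -> 0 <= x) -> 0 <= inf E.
Proof.
move=> E0; have [[x Ex]|/set0P/negP] := pselect (E !=set0).
  by apply: lb_le_inf => //; exists x.
by rewrite negbK => /eqP->; rewrite inf0.
Qed.

Lemma inf_ge0_le {R : realType} (E : set R) (x y : R) :
  (forall z, E z -> 0 <= z) -> E x -> x <= y -> inf E <= y.
Proof. by move=> E0 Ex; apply: le_trans; apply: ge_inf => //; exists 0. Qed.

Lemma dist_line_ge0 {R : realType} (Y X p : R * R) : 0 <= dist_line Y X p.
Proof. by apply: inf_ge0 => _ [q _ <-]; exact: hdist_ge0. Qed.

Lemma dist_line_le {R : realType} (Y X p q : R * R) :
  hline Y X q -> dist_line Y X p <= hdist p q.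
Proof.
move=> Yq; apply: (@inf_ge0_le _ _ (hdist p q)) => //; last by exists q.
by move=> _ [? _ <-]; exact: hdist_ge0.
Qed.

Lemma width_ge0 {R : realType} (K : set (R * R)) (Y X : R * R) : 0 <= width K Y X.
Proof.
by apply: addr_ge0; apply: sup_ge0 => _ [p _ <-]; exact: dist_line_ge0.
Qed.

Lemma thickness_dir_ge0 {R : realType} (K : set (R * R)) (X : R * R) :
  0 <= thickness_dir K X.
Proof. by apply: inf_ge0 => _ [Y _ <-]; exact: width_ge0. Qed.

(** For a support line the points of [K] in the negative half-plane lie on the line, so [width_neg]
    contributes 0 and the width is at most the one-sided bound [e]. *)
Lemma thickness_le {R : realType} (K : set (R * R)) (Y X x : R * R) (e : R) :
  ideal X -> ideal Y -> Y <> X -> K x -> hline Y X x ->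
  K `<=` halfplane_pos Y X ->
  (forall p, K p -> exists2 q, hline Y X q & hdist p q <= e) ->
  thickness K <= e.
Proof.
move=> iX iY YX Kx xYX Kpos Ke.
apply: (@inf_ge0_le _ _ (thickness_dir K X)); [|by exists X|].
  by move=> _ [? _ <-]; exact: thickness_dir_ge0.
apply: (@inf_ge0_le _ _ (width K Y X)).
- by move=> _ [? _ <-]; exact: width_ge0.
- by exists Y => //; split=> //; split=> //; exists x.
rewrite /width -[e]addr0; apply: lerD; apply: ge_sup.
- exists (dist_line Y X x), x => //; split=> //.
  by rewrite /halfplane_pos /= xYX.
- move=> _ [p [Kp _] <-]; have [q Yq] := Ke _ Kp.
  exact: le_trans (dist_line_le _ _ _ _ Yq).
- exists (dist_line Y X x), x => //; split=> //.
  by rewrite /halfplane_neg /= xYX.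
- move=> _ [p [Kp np] <-]; rewrite -(hdistxx p); apply: dist_line_le.
  by apply/eqP; rewrite eq_le np (Kpos _ Kp).
Qed.

(** * Geodesic convexity and nearest points *)

(* The value of a horodisk functional at z is at most a + b times the level, and
   1 = a^2 + b^2 + 2 a b mink x y >= (a + b)^2. *)
Lemma hconvex_cone {R : realType} (K : set (R * R)) (x y z : R * R) (a b : R) :
  hconvex K -> K x -> K y -> 0 <= a -> 0 <= b ->
  z = (a * x.1 + b * y.1, a * x.2 + b * y.2) ->
  height z = a * height x + b * height y -> K z.
Proof.
move=> hK Kx Ky a0 b0 zE hzE; apply: (hK x y) => // X l iX l0.
rewrite /horodisk /= hzE zE /dot /= => xl yl.
have ab1 : a + b <= 1.
  have : a ^+ 2 + b ^+ 2 + 2 * a * b * mink x y = 1.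
    transitivity (a ^+ 2 * mink x x + b ^+ 2 * mink y y + 2 * a * b * mink x y).
      by rewrite !minkxx !mulr1.
    transitivity (mink z z); last exact: minkxx.
    by rewrite /mink hzE zE /dot /=; ring.
  have := mink_ge1 x y; have := mulr_ge0 a0 b0; nra.
have := ler_wpM2l a0 xl; have := ler_wpM2l b0 yl.
have : (a + b) * l <= l by nra.
by rewrite !mulrDr !mulrN !mulrDr; lra.
Qed.

Lemma continuous_fst {R : realType} : continuous (fun p : R * R => p.1).
Proof. by move=> p; exact: cvg_fst. Qed.

Lemma continuous_snd {R : realType} : continuous (fun p : R * R => p.2).
Proof. by move=> p; exact: cvg_snd. Qed.

Lemma continuous_height {R : realType} : continuous (@height R).
Proof.
move=> p; rewrite /height.
apply: (@continuous_comp _ _ _ (fun p => 1 + dot p p) (@Num.sqrt R)).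
  rewrite /dot; apply: cvgD; first exact: cvg_cst.
  by apply: cvgD; apply: cvgM; (exact: continuous_fst || exact: continuous_snd).
exact: sqrt_continuous.
Qed.

(* First variation of q |-> mink z q at its minimizer x, along the geodesic
   from x to q. *)
Lemma nearest_point {R : realType} (K : set (R * R)) (y z : R * R) :
  compact K -> hconvex K -> K y ->
  exists2 x, K x & forall q, K q -> mink z x * mink x q <= mink z q.
Proof.
move=> cK hK Ky.
have cz : continuous (mink z).
  move=> p; rewrite /mink /dot; apply: cvgB.
    by apply: cvgM; [exact: cvg_cst|exact: continuous_height].
  by apply: cvgD; apply: cvgM; (exact: cvg_cst || exact: continuous_fst ||
    exact: continuous_snd).
have [|x /set_mem Kx xmin] := compact_EVT_min _ cK (continuous_subspaceT cz).
  by exists y.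
exists x => // q Kq.
have m1 := mink_ge1 z x; have B1 := mink_ge1 x q; have A1 := mink_ge1 z q.
have key e : 0 < e ->
    mink z x ^+ 2 * (1 + 2 * e * mink x q + e ^+ 2) <= (mink z x + e * mink z q) ^+ 2.
  (* [S] is minus the Minkowski square of [x + e q], so [w] is the normalization of that vector;
     [key] is the minimality of [x] against [w], squared. *)
  move=> e0; set S := 1 + _ + _; pose s := Num.sqrt S.
  have S0 : 0 < S by have := mulr_gt0 e0 (lt_le_trans ltr01 B1); rewrite /S; nra.
  have s0 : 0 < s by rewrite sqrtr_gt0.
  have sE : s ^+ 2 = S by rewrite sqr_sqrtr// ltW.
  have i0 : 0 < s^-1 by rewrite invr_gt0.
  pose w := (s^-1 * x.1 + e / s * q.1, s^-1 * x.2 + e / s * q.2).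
  have hw : height w = s^-1 * height x + e / s * height q.
    apply: heightE.
      by rewrite addr_gt0// !mulr_gt0// height_gt0.
    apply/eqP; rewrite -subr_eq0 /w /=; apply/eqP.
    transitivity ((mink x x + 2 * e * mink x q + e ^+ 2 * mink q q) * s^-1 ^+ 2 - 1).
      by rewrite /mink /dot; ring.
    by rewrite !minkxx mulr1 exprVn sE divff ?subrr// lt0r_neq0.
  have Kw : K w.
    by apply: (hconvex_cone K x q w s^-1 (e / s)) => //; rewrite ltW// mulr_gt0.
  have := xmin w (mem_set Kw).
  have -> : mink z w = (mink z x + e * mink z q) / s.
    by rewrite /mink hw /w /dot /=; ring.
  rewrite ler_pdivlMr// => le.
  have m0 := le_trans ler01 m1; have A0 := le_trans ler01 A1.
  rewrite -sE -exprMn ler_sqr// nnegrE.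
    by rewrite mulr_ge0// ltW.
  by rewrite addr_ge0// mulr_ge0// ltW.
rewrite leNgt; apply/negP => lt.
move: (mink z x) (mink x q) (mink z q) => m B A in m1 B1 A1 key lt *.
pose u := m * B - A; have u0 : 0 < u by rewrite subr_gt0.
(* [key] says that [e * (2 * m * u + e * m ^+ 2 - e * A ^+ 2) <= 0]. This [e] makes the negative
   term equal to [u], which [2 * m * u] outweighs as [m >= 1]. *)
pose e := u / A ^+ 2; have A2 : 0 < A ^+ 2 by rewrite exprn_gt0; lra.
have e0 : 0 < e by rewrite divr_gt0.
have eA : e * A ^+ 2 = u by rewrite divfK// lt0r_neq0.
have := key _ e0.
have : e * (2 * m * u + e * m ^+ 2 - e * A ^+ 2) <= 0 -> False.
  by rewrite eA pmulr_rle0//; nra.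
by rewrite /u; nra.
Qed.

(** * Compactness: the diameter and the maximal triangle *)

(** Boundedness makes the [sup] in [diameter] a genuine upper bound. *)
Lemma compact_mink_bounded {R : realType} (K : set (R * R)) :
  compact K -> K !=set0 -> exists M, forall p q, K p -> K q -> mink p q <= M.
Proof.
move=> cK [y Ky].
have c1 : continuous (fun u : (R * R) * (R * R) => mink u.1 u.2).
  move=> u; rewrite /mink /dot.
  have k1 : {for u, continuous (fun u : (R * R) * (R * R) => u.1)} by exact: cvg_fst.
  have k2 : {for u, continuous (fun u : (R * R) * (R * R) => u.2)} by exact: cvg_snd.
  have comp1 (f : R * R -> R) : continuous f ->
      {for u, continuous (fun u : (R * R) * (R * R) => f u.1)}.
    by move=> cf; apply: (continuous_comp k1); exact: cf.
  have comp2 (f : R * R -> R) : continuous f ->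
      {for u, continuous (fun u : (R * R) * (R * R) => f u.2)}.
    by move=> cf; apply: (continuous_comp k2); exact: cf.
  have H1 := comp1 _ continuous_height; have H2 := comp2 _ continuous_height.
  have F1 := comp1 _ continuous_fst; have F2 := comp2 _ continuous_fst.
  have S1 := comp1 _ continuous_snd; have S2 := comp2 _ continuous_snd.
  exact: (cvgB (cvgM H1 H2) (cvgD (cvgM F1 F2) (cvgM S1 S2))).
have [|[x1 x2] _ xmax] := compact_EVT_max _ (compact_setX cK cK) (continuous_subspaceT c1).
  by exists (y, y).
by exists (mink x1 x2) => p q Kp Kq; exact: (xmax (p, q) (mem_set _)).
Qed.

Lemma hdist_le_diameter {R : realType} (K : set (R * R)) (p q : R * R) :
  compact K -> K p -> K q -> hdist p q <= diameter K.
Proof.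
move=> cK Kp Kq.
have [|M MK] := compact_mink_bounded K cK; first by exists p.
apply: ub_le_sup; last by exists (p, q).
exists (arcosh M) => _ [[a b] [/= Ka Kb] <-].
by apply: ler_arcosh; [exact: mink_ge1|exact: MK].
Qed.

Lemma maximal_triangle {R : realType} (K : set (R * R)) : compact K -> K !=set0 ->
  exists p1 p2 p3, [/\ K p1, K p2, K p3 &
    forall q1 q2 q3, K q1 -> K q2 -> K q3 -> det3 q1 q2 q3 <= det3 p1 p2 p3].
Proof.
move=> cK [y Ky].
have c1 : continuous (fun u : (R * R) * (R * R) * (R * R) => det3 u.1.1 u.1.2 u.2).
  move=> u; rewrite /det3.
  have k1 : {for u, continuous (fun u : (R * R) * (R * R) * (R * R) => u.1.1)}.
    apply: (@continuous_comp _ _ _ fst fst); exact: cvg_fst.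
  have k2 : {for u, continuous (fun u : (R * R) * (R * R) * (R * R) => u.1.2)}.
    apply: (@continuous_comp _ _ _ fst snd); [exact: cvg_fst|exact: cvg_snd].
  have k3 : {for u, continuous (fun u : (R * R) * (R * R) * (R * R) => u.2)}.
    exact: cvg_snd.
  have cont (f : R * R -> R) : continuous f ->
      [/\ {for u, continuous (fun u : (R * R) * (R * R) * (R * R) => f u.1.1)},
          {for u, continuous (fun u : (R * R) * (R * R) * (R * R) => f u.1.2)} &
          {for u, continuous (fun u : (R * R) * (R * R) * (R * R) => f u.2)}].
    move=> cf; split; [apply: (continuous_comp k1)|apply: (continuous_comp k2)|
      apply: (continuous_comp k3)]; exact: cf.
  have [F1 F2 F3] := cont _ continuous_fst.
  have [S1 S2 S3] := cont _ continuous_snd.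
  have [H1 H2 H3] := cont _ continuous_height.
  exact: (cvgD (cvgB (cvgM F1 (cvgB (cvgM S2 H3) (cvgM H2 S3)))
    (cvgM S1 (cvgB (cvgM F2 H3) (cvgM H2 F3))))
    (cvgM H1 (cvgB (cvgM F2 S3) (cvgM S2 F3)))).
have [|[[p1 p2] p3] /set_mem[[/= K1 K2] K3] pmax] :=
  compact_EVT_max _ (compact_setX (compact_setX cK cK) cK) (continuous_subspaceT c1).
  by exists (y, y, y).
exists p1, p2, p3; split=> // q1 q2 q3 *.
exact: (pmax (q1, q2, q3) (mem_set _)).
Qed.

(* height p * det3 p (p + d e1) (p + d e2) = d ^ 2 + O(d ^ 3). *)
Lemma interior_det3 {R : realType} (K : set (R * R)) : K° !=set0 ->
  exists p1 p2 p3, [/\ K p1, K p2, K p3 & 0 < det3 p1 p2 p3].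
Proof.
move=> [p /nbhs_ballP[e /= e0 eK]].
pose N := `|p.1| + `|p.2|.
have N0 : 0 <= N by rewrite addr_ge0.
(* [d < e] keeps the shifted points in the ball, and [d * N < 1] makes the cubic error smaller than
   [d ^+ 2]. *)
pose d := Num.min (e / 2) (1 / (1 + N)).
have d0 : 0 < d by rewrite lt_min !divr_gt0//; lra.
have de : d < e.
  by rewrite gt_min; apply/orP; left; lra.
have dN : d * N < 1.
  have : d <= 1 / (1 + N) by rewrite ge_min lexx orbT.
  by rewrite ler_pdivlMr; lra.
pose p1 := (p.1 + d, p.2); pose p2 := (p.1, p.2 + d).
exists p, p1, p2.
have ballK q : `|p.1 - q.1| < e -> `|p.2 - q.2| < e -> K q.
  by move=> *; apply: eK; split.
have dabs : `|d| < e by rewrite gtr0_norm.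
split.
- by apply: ballK; rewrite subrr normr0.
- by apply: ballK; rewrite /= ?subrr ?normr0// opprD addrA subrr sub0r normrN.
- by apply: ballK; rewrite /= ?subrr ?normr0// opprD addrA subrr sub0r normrN.
have h0 := height_gt0 p; have h1 := height_gt0 p1; have h2 := height_gt0 p2.
have hE := height_sqr p; have hE1 := height_sqr p1; have hE2 := height_sqr p2.
rewrite /= in hE1 hE2.
(* The remainder [v] is nonnegative by [mink_ge1] and at most [d ^+ 2 / 2] by the inequality of
   arithmetic and geometric means. *)
have bound q u : (height q) ^+ 2 = height p ^+ 2 + 2 * d * u + d ^+ 2 ->
   height p * height q >= height p ^+ 2 + d * u ->
   exists2 v, height p * height q = height p ^+ 2 + d * u + v & 0 <= v <= d ^+ 2 / 2.
  move=> E L; exists (height p * height q - (height p ^+ 2 + d * u)); first by ring.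
  have := sqr_ge0 (height p - height q); nra.
have [||v1 E1 /andP[v10 v1d]] := bound p1 p.1.
- by rewrite hE1 hE; ring.
- by have := mink_ge1 p p1; rewrite /mink /dot hE /=; lra.
have [||v2 E2 /andP[v20 v2d]] := bound p2 p.2.
- by rewrite hE2 hE; ring.
- by have := mink_ge1 p p2; rewrite /mink /dot hE /=; lra.
rewrite -(pmulr_rgt0 _ h0).
have -> : height p * det3 p p1 p2 = d * (d - (p.1 * v1 + p.2 * v2)).
  rewrite /det3 /=.
  transitivity (height p ^+ 2 * d * (d + p.1 + p.2) - d * p.1 * (height p * height p1)
    - d * p.2 * (height p * height p2)); first by ring.
  rewrite E1 E2 hE; ring.
rewrite pmulr_rgt0// subr_gt0.
have : p.1 * v1 + p.2 * v2 <= N * (d ^+ 2 / 2).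
  rewrite /N mulrDl; apply: lerD.
    apply: le_trans (ler_wpM2r v10 (ler_norm _)) _; exact: ler_wpM2l.
  apply: le_trans (ler_wpM2r v20 (ler_norm _)) _; exact: ler_wpM2l.
move=> le; apply: le_lt_trans le _; nra.
Qed.

(** * The radius, the centroid and support forms *)

(** With [g], [s] the sinh of [r], [t] and [C], [D] the cosh of [t], [d], squaring the equation
    gives [g ^+ 2 * ((3 * D ^+ 2 + s ^+ 2) ^+ 2 - s ^+ 2 * C ^+ 2) = s ^+ 2 * C ^+ 2]. The rest
    follows from [C <= D] and [3 + 6 * D <= 9 * D ^+ 2]. *)
Lemma radius_bound {R : realType} (r t d : R) : 0 <= t -> t <= d ->
  tanh r = sinh t * cosh t / (3 * cosh d ^+ 2 + sinh t ^+ 2) ->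
  sinh r ^+ 2 * (3 + 6 * cosh d) <= sinh t ^+ 2.
Proof.
move=> t0 td; rewrite /tanh => /eqP.
have CD := ler_cosh _ _ t0 td.
have := cosh2_sinh2 r; have := cosh2_sinh2 t.
have := cosh_gt0 r; have := cosh_ge1 t.
move: (cosh d) (cosh t) (sinh t) (cosh r) (sinh r) CD => D C s k g CD C1 k0 sE kE.
have D1 : 1 <= D by lra.
have Q0 : 0 < 3 * D ^+ 2 + s ^+ 2 by nra.
rewrite eqr_div ?lt0r_neq0// => /eqP gE.
have := congr1 (fun x => x ^+ 2) gE; rewrite !exprMn => gE2.
have gE3 : g ^+ 2 * ((3 * D ^+ 2 + s ^+ 2) ^+ 2 - s ^+ 2 * C ^+ 2) = s ^+ 2 * C ^+ 2.
  by rewrite mulrBr gE2 kE; ring.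
have C20 : 0 < C ^+ 2 by nra.
rewrite -(ler_pM2r C20) -gE3 -mulrA ler_wpM2l ?sqr_ge0//.
have D2C : C ^+ 2 <= D ^+ 2 by nra.
have D9 : 3 + 6 * D <= 9 * D ^+ 2 by nra.
have s2 : 0 <= s ^+ 2 := sqr_ge0 s.
have : (3 + 6 * D) * C ^+ 2 <= 9 * D ^+ 2 * D ^+ 2 by apply: ler_pM => //; nra.
have : s ^+ 2 * C ^+ 2 <= s ^+ 2 * D ^+ 2 by exact: ler_wpM2l.
have := mulr_ge0 s2 s2; have := mulr_ge0 s2 (sqr_ge0 D); lra.
Qed.

(** [S] is minus the Minkowski square of the sum of the three lifts, and [c] is that sum
    normalized. *)
Lemma centroid {R : realType} (p1 p2 p3 : R * R) :
  let S := 3 + 2 * (mink p1 p2 + mink p2 p3 + mink p1 p3) in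
  exists c, forall u v w,
    linform u v w p1 + linform u v w p2 + linform u v w p3 = Num.sqrt S * linform u v w c.
Proof.
move=> S; set s := Num.sqrt S.
have S0 : 0 < S.
  by have := mink_ge1 p1 p2; have := mink_ge1 p2 p3; have := mink_ge1 p1 p3; rewrite /S; lra.
have s0 : 0 < s by rewrite sqrtr_gt0.
have sE : s ^+ 2 = S by rewrite sqr_sqrtr// ltW.
pose c := ((p1.1 + p2.1 + p3.1) / s, (p1.2 + p2.2 + p3.2) / s).
have hc : height c = (height p1 + height p2 + height p3) / s.
  apply: heightE; first by rewrite divr_gt0// !addr_gt0// height_gt0.
  rewrite /c /=; apply/eqP; rewrite -subr_eq0; apply/eqP.
  transitivity ((mink p1 p1 + mink p2 p2 + mink p3 p3 +
    2 * (mink p1 p2 + mink p2 p3 + mink p1 p3)) * s^-1 ^+ 2 - 1).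
    by rewrite /mink /dot; ring.
  rewrite !minkxx exprVn sE.
  by have -> : 1 + 1 + 1 + 2 * (mink p1 p2 + mink p2 p3 + mink p1 p3) = S;
    [rewrite /S; ring|rewrite divff ?subrr// lt0r_neq0].
exists c => u v w; rewrite /linform hc /c /=; field.
by rewrite lt0r_neq0.
Qed.

(** In Cramer's rule each numerator is at most the maximal determinant and multiplies a nonnegative
    value of the form. *)
Lemma form_le_triangle {R : realType} (K : set (R * R)) (p1 p2 p3 q : R * R) (a b c : R) :
  0 < det3 p1 p2 p3 ->
  (forall q1 q2 q3, K q1 -> K q2 -> K q3 -> det3 q1 q2 q3 <= det3 p1 p2 p3) ->
  (forall q, K q -> 0 <= linform a b c q) ->
  K p1 -> K p2 -> K p3 -> K q ->
  linform a b c q <= linform a b c p1 + linform a b c p2 + linform a b c p3.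
Proof.
move=> D0 Dmax f0 K1 K2 K3 Kq; rewrite -(ler_pM2l D0) det3_cramer.
rewrite [leRHS]mulrDr [X in _ <= X + _]mulrDr.
by apply: lerD; first apply: lerD; apply: ler_wpM2r; rewrite ?f0// Dmax.
Qed.

Lemma thickness_le_form {R : realType} (K : set (R * R)) (x : R * R) (a b c e : R) :
  0 < a ^+ 2 + b ^+ 2 - c ^+ 2 -> K x -> linform a b c x = 0 ->
  (forall p, K p -> 0 <= linform a b c p) ->
  (forall p, K p -> exists2 q, linform a b c q = 0 & hdist p q <= e) ->
  thickness K <= e.
Proof.
move=> /form_side[X [Y [iX iY YX [l l0 lE]]]] Kx fx f0 fe.
apply: (@thickness_le _ K Y X x) => //.
- by rewrite /hline /= lE fx mulr0.
- by move=> p Kp; rewrite /halfplane_pos /= lE mulr_ge0// ?f0// ltW.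
- move=> p /fe[q fq qe]; exists q => //.
  by rewrite /hline /= lE fq mulr0.
Qed.

(** * The inscribed disk *)

Theorem theorem4 (R : realType) (K : set (R * R)) (d t r : R)
    (bodyK : body K) (hconvexK : hconvex K)
    (dE : diameter K = d) (tE : thickness K = t)
    (rE : tanh r = sinh t * cosh t / (3 * cosh d ^+ 2 + sinh t ^+ 2)) :
  exists c : R * R, hdisk c r `<=` K.
Proof.
(* For negative [t] the equation makes [tanh r] negative, so the disk is empty and any centre
   serves. *)
have [t0|t0] := ltP t 0.
  exists (0, 0) => z /= /(le_trans (hdist_ge0 _ _)) /sinh_ge0 r0.
  have : 0 <= tanh r by rewrite divr_ge0// ltW// cosh_gt0.
  have D0 : 0 < 3 * cosh d ^+ 2 + sinh t ^+ 2.
    by rewrite ltr_pwDl ?sqr_ge0// mulr_gt0// exprn_gt0// cosh_gt0.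
  rewrite rE leNgt pmulr_llt0 ?invr_gt0// nmulr_rlt0 ?cosh_gt0//.
  exact: sinh_lt0.
have [cK Kint] := bodyK.
have [q1 [q2 [q3 [Q1 Q2 Q3 Q0]]]] := interior_det3 K Kint.
have [|p1 [p2 [p3 [K1 K2 K3 Kmax]]]] := maximal_triangle K cK; first by exists q1.
have D0 := lt_le_trans Q0 (Kmax _ _ _ Q1 Q2 Q3).
have Kd p q : K p -> K q -> hdist p q <= d.
  by move=> Kp Kq; rewrite -dE; exact: hdist_le_diameter.
have Kmd p q : K p -> K q -> mink p q <= cosh d.
  by move=> Kp Kq; rewrite -cosh_hdist; apply: ler_cosh; [exact: hdist_ge0|exact: Kd].
have [c cE] := centroid p1 p2 p3.
exists c => z /= cz; apply: contrapT => Kz.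
have [x Kx zx] := nearest_point K p1 z cK hconvexK K1.
have m1 : 1 < mink z x by apply: mink_gt1 => zxE; apply: Kz; rewrite zxE.
set m := mink z x in zx m1.
(* The support form at [x], left unnormalized: [mink z q - m * mink x q], whose normal has Minkowski
   square [m ^+ 2 - 1], the squared sinh of the distance from [z] to [x]. *)
pose u := m * x.1 - z.1; pose v := m * x.2 - z.2; pose w := height z - m * height x.
have fE q : linform u v w q = mink z q - m * mink x q.
  by rewrite /linform /mink /dot /u /v /w; ring.
have NE : u ^+ 2 + v ^+ 2 - w ^+ 2 = m ^+ 2 - 1.
  transitivity (2 * m * mink z x - mink z z - m ^+ 2 * mink x x).
    by rewrite /u /v /w /mink /dot; ring.
  by rewrite !minkxx -/m; ring.
have N0 : 0 < u ^+ 2 + v ^+ 2 - w ^+ 2 by rewrite NE; nra.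
have f0 q : K q -> 0 <= linform u v w q by move=> Kq; rewrite fE subr_ge0 zx.
have fx : linform u v w x = 0 by rewrite fE minkxx mulr1 subrr.
(* The support line passes through [x], and all of [K] is within [d] of [x]. *)
have td : t <= d.
  rewrite -tE; apply: (thickness_le_form K x u v w) => // p Kp.
  by exists x => //; exact: Kd.
pose F := linform u v w p1 + linform u v w p2 + linform u v w p3.
have F0 : 0 <= F by exact: (addr_ge0 (addr_ge0 (f0 _ K1) (f0 _ K2)) (f0 _ K3)).
have tF : sinh t ^+ 2 * (m ^+ 2 - 1) <= F ^+ 2.
  rewrite -NE -ler_pdivlMr//.
  (* By [foot] and [form_le_triangle], every point of [K] is at distance at most
     [arcosh (Num.sqrt (1 + T))] from the support line. *)
  set T := F ^+ 2 / _.
  have T0 : 0 <= T by rewrite divr_ge0 ?sqr_ge0// ltW.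
  have e1 : 1 <= Num.sqrt (1 + T) by rewrite -[leLHS]sqrtr1 ler_sqrt; lra.
  have te : t <= arcosh (Num.sqrt (1 + T)).
    rewrite -tE; apply: (thickness_le_form K x u v w) => // p Kp.
    have [q fq pq] := foot u v w p N0.
    exists q => //; apply: ler_arcosh; first exact: mink_ge1.
    rewrite -/(mink p q) pq ler_sqrt; last by lra.
    rewrite lerD2l ler_pM2r ?invr_gt0// ler_sqr ?nnegrE ?f0//.
    exact: (form_le_triangle K).
  have := ler_cosh _ _ t0 te; rewrite arcoshK// => ct.
  rewrite -(lerD2l 1) -cosh2_sinh2.
  have <- : Num.sqrt (1 + T) ^+ 2 = 1 + T by rewrite sqr_sqrtr//; lra.
  by rewrite ler_sqr ?nnegrE//; have := cosh_gt0 t; lra.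
have := radius_bound _ _ _ t0 td rE.
have rc : mink c z <= cosh r.
  by rewrite -cosh_hdist; apply: ler_cosh; first exact: hdist_ge0.
have := cosh2_sinh2 r.
have := mink_gram z x c; rewrite -fE.
have := fE c; have := cE u v w; rewrite -/F.
set S := 3 + _.
have S3 : 3 <= S <= 3 + 6 * cosh d.
  have := mink_ge1 p1 p2; have := mink_ge1 p2 p3; have := mink_ge1 p1 p3.
  have := Kmd _ _ K1 K2; have := Kmd _ _ K2 K3; have := Kmd _ _ K1 K3.
  by rewrite /S; lra.
have := sqr_ge0 (det3 z x c).
have sE : Num.sqrt S ^+ 2 = S by rewrite sqr_sqrtr//; lra.
have B1 := mink_ge1 x c.
rewrite minkC in rc.
have q0 : 0 < Num.sqrt S by rewrite sqrtr_gt0; lra.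
move=> D2 FE AE G rE2 gS.
have fc0 : 0 <= linform u v w c by rewrite -(pmulr_rge0 _ q0) -FE.
have FS : F ^+ 2 = S * linform u v w c ^+ 2 by rewrite FE exprMn sE.
move: D2 FS AE G rE2 gS fc0 rc B1 tF S3 {sE q0 FE}.
rewrite -/m; move: (mink z c) (mink x c) (linform _ _ _ c) => A B f.
move: (cosh r) (sinh r) (sinh t) (cosh d) (det3 _ _ _ ^+ 2) S => k g s D X T.
move=> X0 FS AE G kE gS fc0 rc B1 tF /andP[T3 TD].
have n0 : 0 < m ^+ 2 - 1 by nra.
have mB : 0 <= m * B by nra.
have A2 : (m * B) ^+ 2 <= k ^+ 2 by rewrite ler_sqr ?nnegrE; lra.
have B2 : 1 <= B ^+ 2 by nra.
(* From [m * B <= A <= k] and [m > 1]: the point [x] is strictly closer to [c] than [r]. *)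
have gB : B ^+ 2 - 1 < g ^+ 2.
  have : m ^+ 2 - 1 <= (m ^+ 2 - 1) * B ^+ 2 by rewrite ler_peMr// ltW.
  by rewrite exprMn in A2; lra.
(* The Gram identity gives [f ^+ 2 <= (m ^+ 2 - 1) * (B ^+ 2 - 1)]. Multiplied by [T], the strict
   bound contradicts [tF] combined with [radius_bound]. *)
have H : f ^+ 2 < (m ^+ 2 - 1) * g ^+ 2.
  have : (m ^+ 2 - 1) * (B ^+ 2 - 1) < (m ^+ 2 - 1) * g ^+ 2 by rewrite ltr_pM2l.
  lra.
have H1 : g ^+ 2 * T <= s ^+ 2 by apply: le_trans gS; rewrite ler_wpM2l ?sqr_ge0.
have H2 := ler_wpM2r (ltW n0) H1.
have T0 : 0 < T by lra.
have := H; rewrite -(ltr_pM2l T0); lra.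
Qed.
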